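(* For a nonempty additive analytic set $A$ in a Polish group $X$ the following conditions are equivalent: (1) the subgroup $A-A$ is not open in $X$; (2) the subgroup $A-A$ is meager in $X$; (3) $A$ is generically Haar-$1$; (4) $A$ is null-$n$ for some $n\in\mathbb N$; (5) $A$ is not finitely thick in any open subgroup $H\subset X$ containing $A$.
   Context: All groups are Abelian, written additively; a Polish group is a topological group whose underlying space is Polish. $\mathbb N=\{1,2,\dots\}$. $A$ is additive if $A+A\subset A$ (then, for nonempty $A$, $A-A=\{a-b:a,b\in A\}$ is a subgroup). A space is analytic if it is a continuous image of a Polish space. $A$ is generically Haar-$1$ if the set $\{f\in C(2^\omega,X):\forall x\in X\;\;|f^{-1}(A+x)|\le1\}$ is comeager in the space $C(2^\omega,X)$ of continuous maps from the Cantor cube $2^\omega=\{0,1\}^\omega$ to $X$ with the compact-open topology. $A$ is null-$n$ if there is a continuous map $f:\omega+1\to X$ (where $\omega+1$ carries the order topology, i.e. is a convergent sequence with its limit) such that $|f^{-1}(x+A)|\le n$ for every $x\in X$. A subset $A$ of a topological group $H$ is finitely thick (in $H$) if for any finite set $F\subset H$ there is $x\in H$ such that $F\subset x+A$. *)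

(* Defs.v *)
From HB Require Import structures.
From mathcomp Require Import all_boot all_order all_algebra.
From mathcomp Require Import all_classical all_reals all_analysis.

Set Implicit Arguments.
Unset Strict Implicit.
Unset Printing Implicit Defensive.

Import Order.TTheory GRing.Theory Num.Theory.
Local Open Scope classical_set_scope.
Local Open Scope card_scope.
Local Open Scope ring_scope.

Definition nowhere_dense (T : topologicalType) (S : set T) : Prop :=
  (closure S)^° = set0.

Definition meager (T : topologicalType) (S : set T) : Prop :=
  exists2 F : nat -> set T, (forall n, nowhere_dense (F n)) & S = \bigcup_n F n.

Definition comeager (T : topologicalType) (S : set T) : Prop := meager (~` S).

Definition separable (T : topologicalType) : Prop :=
  exists2 D : set T, countable D & dense D.

Definition complete_metric (R : realType) (M : metricType R) : Prop :=
  forall F : set_system M, ProperFilter F -> cauchy F -> exists l : M, F --> l.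

Definition homeomorphic (S T : topologicalType) : Prop :=
  exists (h : S -> T) (g : T -> S),
    [/\ cancel h g, cancel g h, continuous h & continuous g].

(* [T] comes without a preferred metric, so complete metrizability asks for a
   homeomorphism with some complete metric space. The library's [completeType]
   is not used because it bundles a distinguished point. *)
Definition polish (R : realType) (T : topologicalType) : Prop :=
  separable T /\
  exists2 M : metricType R, complete_metric M & homeomorphic M T.

(* [A] carries the subspace topology, so that a continuous surjection onto [A]
   is a continuous map to [T] whose range is [A]. *)
Definition analytic (R : realType) (T : topologicalType) (A : set T) : Prop :=
  exists P : topologicalType, polish R P /\
    exists2 f : P -> T, continuous f & range f = A.

(* The ordinal omega + 1: [Some n] is the natural number n and [None] is the
   top element omega. *)
Definition omega_plus1 : Type := option nat.

HB.instance Definition _ := Choice.on omega_plus1.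

Definition omega_le (x y : omega_plus1) : bool :=
  match x, y with
  | _, None => true
  | None, Some _ => false
  | Some m, Some n => (m <= n)%N
  end.

Lemma omega_le_refl : reflexive omega_le.
Proof. by case=> [n|] //=. Qed.

Lemma omega_le_anti : antisymmetric omega_le.
Proof. by move=> [m|] [n|] //= /anti_leq ->. Qed.

Lemma omega_le_trans : transitive omega_le.
Proof. by move=> [m|] [n|] [p|] //=; exact: leq_trans. Qed.

Lemma omega_le_total : total omega_le.
Proof. by move=> [m|] [n|] //=; exact: leq_total. Qed.

Fact omega_display : Order.disp_t. Proof. exact: Order.Disp tt tt. Qed.

HB.instance Definition _ := @Order.Le_isPOrder.Build omega_display omega_plus1
  omega_le omega_le_refl omega_le_anti omega_le_trans.
HB.instance Definition _ := Order.POrder_isTotal.Build omega_display omega_plus1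
  omega_le_total.

Definition translate (X : zmodType) (x : X) (A : set X) : set X :=
  [set x + a | a in A].

Definition diffset (X : zmodType) (A : set X) : set X :=
  [set a - b | a in A & b in A].

Definition additive_set (X : zmodType) (A : set X) : Prop :=
  [set a + b | a in A & b in A] `<=` A.

Definition subgroup (X : zmodType) (H : set X) : Prop := zmod_closed (mem H).

Definition finitely_thick (X : zmodType) (H A : set X) : Prop :=
  forall F : set X, finite_set F -> F `<=` H ->
    exists2 x, H x & F `<=` translate x A.

Section haar.
(* Gives [continuousType U V] the compact-open topology. *)
Import ArrowAsCompactOpen.

Definition generically_haar (n : nat) (X : topologicalZmodType) (A : set X) :
    Prop :=
  comeager [set f : continuousType cantor_space X |
    forall x : X, f @^-1` (translate x A) #<= `I_n].

End haar.

Definition null_n (n : nat) (X : topologicalZmodType) (A : set X) : Prop :=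
  exists2 f : order_topology omega_plus1 -> X, continuous f &
    forall x : X, f @^-1` (translate x A) #<= `I_n.

(* Main.v *)
Require Import Defs.
From mathcomp Require Import all_boot all_order all_algebra.
From mathcomp Require Import all_classical all_reals all_analysis.

Set Implicit Arguments.
Unset Strict Implicit.
Unset Printing Implicit Defensive.

Import Order.TTheory GRing.Theory Num.Theory.
Local Open Scope classical_set_scope.
Local Open Scope card_scope.
Local Open Scope ring_scope.

(** Write [G] for [diffset A]; additivity of [A] makes [G] a subgroup. The
    equivalence is a cycle of implications, of which the first and the third
    carry the weight.

    If [G] is not meager, it is open. [G] is the image of a Polish space, and a
    nonmeager set [W] of this kind is comeager in some nonempty open set
    ([suslin_scheme_heavy_core]). Indeed, cut the source into countably many
    smaller and smaller pieces. Call a point heavy for a piece when it is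
    interior to the set of points near which the image of the piece is
    nonmeager everywhere. Outside a meager set, a point heavy for a piece is
    heavy for one of its subpieces; following a branch of such pieces and using
    completeness of the source shows that the point lies in the image. A
    subgroup comeager in a nonempty open set is open ([pettis_subgroup]): if two
    translates of that open set overlap, so do the corresponding translates of
    [G], because the space is Baire.

    If [G] is the union of nowhere dense sets [M n], then a generic continuous
    map [f] on the Cantor space satisfies [f s - f t] outside every [M n] for
    all distinct [s] and [t], whence its values lie in distinct cosets of [G]:
    each basic open set of maps contains step maps, whose finitely many values
    can be moved by small amounts so that all their differences avoid [M n],
    with room left around them ([nowhere_dense_collision]).

    A generic property yields an actual map because the space of maps is Baire
    ([continuous_map_baire]), and the restriction of such a map to a convergent
    sequence shows that [A] is null-1. If [A] is null-n, then [n + 1] terms of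
    the witnessing sequence, close enough to its limit, form after translation
    a finite subset of [H] that no translate of [A] contains. Finally, if [G] is
    open, it is itself an open subgroup containing [A] in which [A] is finitely
    thick: add up the subtrahends of the finitely many differences to be
    covered ([finitely_thick_diffset]).

    All Baire category arguments, in the group as well as in the space of maps,
    are winning strategies in the Choquet game ([choquet_baire]), and the
    metric of a Polish space enters only through [complete_covers]. *)

(** * Meager sets and Baire spaces *)

Lemma nowhere_denseP (T : topologicalType) (S : set T) :
  nowhere_dense S <-> forall U, open U -> U !=set0 ->
    exists V, [/\ open V, V !=set0, V `<=` U & V `&` S = set0].
Proof.
split=> [Snd U oU U0|H].
  exists (U `&` ~` closure S); split.
  - by apply: openI => //; rewrite openC; exact: closed_closure.
  - apply: contrapT => /nonemptyPn E.
    have US : U `<=` closure S.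
      move=> x Ux; apply: contrapT => nS.
      by have : set0 x by rewrite -E.
    case: U0 => x Ux; have : (closure S)^° x.
      by apply: (filterS US); exact: open_nbhs_nbhs.
    by rewrite Snd.
  - exact: subIsetl.
  - rewrite -subset0 => x [[_ nS] Sx]; apply: nS.
    exact: subset_closure.
apply/seteqP; split => // x Sx.
have [V [oV [y Vy] VS VS0]] := H _ (open_interior _) (ex_intro _ x Sx).
have /interior_subset/(_ V (open_nbhs_nbhs (conj oV Vy)))[z [Sz Vz]] :=
  VS y Vy.
by have : set0 z by rewrite -VS0.
Qed.

Lemma nowhere_denseS (T : topologicalType) (S S' : set T) :
  S `<=` S' -> nowhere_dense S' -> nowhere_dense S.
Proof.
move=> SS' nS'; apply/seteqP; split => // x.
by move/(interiorS (closureS SS')); rewrite nS'.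
Qed.

Lemma meagerS (T : topologicalType) (S S' : set T) :
  S `<=` S' -> meager S' -> meager S.
Proof.
move=> SS' [F ndF S'E]; exists (fun n => F n `&` S).
  by move=> n; apply: nowhere_denseS (ndF n); exact: subIsetl.
by rewrite -setI_bigcupl -S'E setIC; apply/esym/setIidPl.
Qed.

Lemma nowhere_dense_meager (T : topologicalType) (S : set T) :
  nowhere_dense S -> meager S.
Proof.
by move=> nS; exists (fun=> S) => //; rewrite bigcup_const//; exists 0%N.
Qed.

Lemma meager0 (T : topologicalType) : meager (@set0 T).
Proof.
by apply: nowhere_dense_meager; rewrite /nowhere_dense closure0 interior0.
Qed.

Lemma meager_bigcup (T : topologicalType) (I : countType) (S : I -> set T) :
  (forall i, meager (S i)) -> meager (\bigcup_i S i).
Proof.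
move=> mS; have /choice[F FP] : forall i, exists F : nat -> set T,
    (forall n, nowhere_dense (F n)) /\ S i = \bigcup_n F n.
  by move=> i; have [F] := mS i; exists F.
exists (fun k => if unpickle k is Some (i, n) then F i n else set0).
  move=> k; case: unpickle => [[i n]|]; first exact: (FP i).1.
  by rewrite /nowhere_dense closure0 interior0.
apply/seteqP; split=> x.
  move=> [i _]; rewrite (FP i).2 => -[n _ Fx].
  by exists (pickle (i, n)) => //; rewrite pickleK.
move=> [k _]; case: unpickle => [[i n] Fx|//].
by exists i => //; rewrite (FP i).2; exists n.
Qed.

Lemma meagerU (T : topologicalType) (S S' : set T) :
  meager S -> meager S' -> meager (S `|` S').
Proof.
move=> mS mS'; apply: (@meagerS _ _ (\bigcup_b if b then S else S')).
  by move=> x [Sx|S'x]; [exists true|exists false].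
by apply: meager_bigcup => -[].
Qed.

Lemma meager_preimage (S T : topologicalType) (h : S -> T) (g : T -> S)
    (A : set T) : continuous h -> continuous g -> cancel h g -> cancel g h ->
  meager A -> meager (h @^-1` A).
Proof.
move=> ch cg hK gK [F ndF ->]; exists (fun n => h @^-1` F n); last first.
  exact: preimage_bigcup.
move=> n; apply/nowhere_denseP => U oU [x Ux].
have gU0 : g @^-1` U !=set0 by exists (h x); rewrite /preimage/= hK.
have ogU : open (g @^-1` U) by apply: open_comp.
have [V [oV [y Vy] VU VF]] := (nowhere_denseP (F n)).1 (ndF n) _ ogU gU0.
exists (h @^-1` V); split.
- by apply: open_comp.
- by exists (g y); rewrite /preimage/= gK.
- by move=> z /VU; rewrite /preimage/= hK.
- by rewrite -preimage_setI VF preimage_set0.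
Qed.

(** Nonempty open sets are not meager, in the form in which the property is
    applied: a point of [W] avoiding [S]. *)
Definition baire (T : topologicalType) : Prop :=
  forall W S : set T, open W -> W !=set0 -> meager S -> exists2 x, W x & ~ S x.

(** The second player of the Choquet game answers a move [E] at stage [n] by
    [sigma n E], and this wins when the moves always have a common point. When
    the first player removes one more nowhere dense set at each stage, that
    common point avoids all of them. *)
Lemma choquet_baire (T : topologicalType) (sigma : nat -> set T -> set T) :
  (forall n E, open E -> E !=set0 ->
     [/\ open (sigma n E), sigma n E !=set0 & sigma n E `<=` E]) ->
  (forall E : nat -> set T, (forall n, open (E n)) ->
     (forall n, E n !=set0) -> (forall n, E n.+1 `<=` sigma n (E n)) ->
     \bigcap_n E n !=set0) ->
  baire T.
Proof.
move=> sigmaP capP W S oW W0 [F ndF ->].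
pose E := fix E n := if n is m.+1 then sigma m (E m) `\` closure (F m) else W.
have EP n : open (E n) /\ E n !=set0.
  elim: n => [//|n [oE E0]] /=; have [osE sE0 _] := sigmaP n _ oE E0.
  have [V [oV [y Vy] VsE VF]] := (nowhere_denseP _).1 (ndF n) _ osE sE0.
  split; first by apply: openI => //; rewrite openC; exact: closed_closure.
  exists y; split; first exact: VsE.
  move/(_ V (open_nbhs_nbhs (conj oV Vy))) => [z [Fz Vz]].
  by have : set0 z by rewrite -VF.
have [n|n|n|x Ex] := capP E; [exact: (EP n).1|exact: (EP n).2| |].
  exact: subDsetl.
exists x; first exact: (Ex 0%N).
by move=> [n _ Fx]; have [_] := Ex n.+1 I; apply; exact: subset_closure.
Qed.

(** * Polish spaces through complete sequences of covers *)

(** [small n] stands for the sets of diameter at most [1/(n+1)]: these four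
    properties are all that is needed of a complete separable metric, and they
    speak of the topology alone, so that they transfer along homeomorphisms. *)
Definition complete_covers (T : topologicalType) (small : nat -> set (set T)) :=
  [/\ forall n V W, V `<=` W -> small n W -> small n V,
      forall n x U, nbhs x U ->
        exists V, [/\ open V, V x, closure V `<=` U & small n V],
      forall V : nat -> set T, (forall n, V n !=set0) ->
        (forall n, V n.+1 `<=` V n) -> (forall n, small n (V n)) ->
        exists x : T, forall U, nbhs x U -> exists n, V n `<=` U
    & forall n, exists V : nat -> set T,
        (forall i, small n (V i)) /\ \bigcup_i V i = setT].

Lemma polish_complete_covers (R : realType) (T : topologicalType) :
  polish R T -> exists small : nat -> set (set T), complete_covers small.
Proof.
move=> [[D cD dD] [M cM [h [g [hK gK ch cg]]]]].
(* Smallness is a bound on distances, and so holds of the empty set. *)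
pose r n : R := n.+1%:R^-1.
have r0 n : 0 < r n by rewrite invr_gt0 ltr0n.
have nbhs_preball x e : 0 < e -> nbhs x (g @^-1` ball (g x) e).
  by move=> e0; apply: cg; exact: nbhsx_ballx.
exists (fun n => [set V | forall x y, V x -> V y -> ball (g x) (r n) (g y)]).
split.
- by move=> n V W VW sW x y /VW Wx /VW Wy; exact: sW.
- move=> n x U; rewrite -{1}(gK x) => /ch; rewrite nbhs_simpl/=.
  rewrite -filter_from_ballE => -[e /= e0 eU].
  pose s := Order.min (e / 2) (r n / 2).
  have s0 : 0 < s by rewrite /s lt_min !divr_gt0.
  have small z : (ball (g x) s)° (g z) -> ball (g x) s (g z).
    by move/interior_subset.
  exists (g @^-1` (ball (g x) s)°); split.
  + by apply: open_comp => //; exact: open_interior.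
  + by rewrite /preimage/=; apply: nbhsx_ballx.
  + have e20 : 0 < e / 2 by rewrite divr_gt0.
    move=> y /(_ _ (nbhs_preball y (e / 2) e20))[z [/small xz yz]].
    rewrite -(gK y); apply: eU; rewrite [e]splitr.
    apply: (ball_triangle _ (ball_sym yz)).
    by apply: (le_ball _ xz); rewrite /s ge_min lexx.
  + move=> y z /small xy /small xz; rewrite [r n]splitr.
    have le_s : s <= r n / 2 by rewrite /s ge_min lexx orbT.
    apply: (@ball_triangle _ _ (g x)).
      by apply: ball_sym; exact: (le_ball le_s).
    exact: (le_ball le_s).
- move=> V V0 decV smallV.
  pose F := filter_from setT (fun n => g @` V n).
  have leV m n : (m <= n)%N -> V n `<=` V m.
    by move=> /subnK <-; elim: (n - m)%N => // k IH x /decV; exact: IH.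
  have FF : ProperFilter F.
    apply: filter_from_proper.
      apply: filter_from_filter; first by exists 0%N.
      move=> i j _ _; exists (maxn i j) => // _ [x Vx <-].
      split; exists x => //.
        by apply: leV Vx; exact: leq_maxl.
      by apply: leV Vx; exact: leq_maxr.
    by move=> n _; have [x Vx] := V0 n; exists (g x), x.
  have [l Fl] : exists l : M, F --> l.
    apply: cM; apply: cauchy_exP => e e0.
    have [n ne] : exists n, r n < e.
      exists (Num.truncn e^-1); rewrite /r.
      by rewrite -ltf_pV2 ?posrE ?invr_gt0// invrK truncnS_gt.
    have [x Vx] := V0 n; exists (g x), n => // _ [y Vy <-].
    exact: (le_ball (ltW ne) (smallV _ _ _ Vx Vy)).
  exists (h l) => U /ch/Fl[n _ VU]; exists n => x Vx.
  by rewrite -(gK x); apply: VU; exists x.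
- move=> n; have /countable_injP[c cinj] := cD.
  exists (fun i z => exists d, [/\ D d, c d = i & ball (g d) (r n / 2) (g z)]).
  split.
    move=> i x y [d [Dd di dx]] [d' [Dd' d'i d'y]].
    have dd' : d = d' by apply: cinj; rewrite ?inE// di.
    rewrite [r n]splitr; apply: (@ball_triangle _ _ (g d)).
      exact: ball_sym.
    by rewrite dd'.
  apply/seteqP; split => // x _.
  pose W := (g @^-1` ball (g x) (r n / 2))°.
  have Wx : W x by apply: nbhs_preball; rewrite divr_gt0.
  have [d [/interior_subset dx Dd]] := dD W (ex_intro _ x Wx) (open_interior _).
  by exists (c d) => //; exists d; split => //; exact: ball_sym.
Qed.

Lemma polish_hausdorff (R : realType) (T : topologicalType) :
  polish R T -> hausdorff_space T.
Proof.
move=> [_ [M _ [h [g [_ gK ch cg]]]]] p q pq.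
rewrite -(gK p) -(gK q); congr h; apply: metric_hausdorff => U V /cg pU /cg qV.
by have [z [Uz Vz]] := pq _ _ pU qV; exists (g z).
Qed.

(** Answering with a small open set whose closure lies in the last move, a
    player makes the moves shrink to a point, which then belongs to all of
    them. *)
Lemma complete_covers_baire (T : topologicalType) (small : nat -> set (set T)) :
  complete_covers small -> baire T.
Proof.
move=> [smallS smallN smallC _].
have /choice[sigma sigmaP] : forall nE : nat * set T, exists V : set T,
    open nE.2 -> nE.2 !=set0 ->
    [/\ open V, V !=set0, closure V `<=` nE.2 & small nE.1 V].
  move=> [n E]; have [[oE [x Ex]]|nE] := pselect (open E /\ E !=set0).
    have [V [oV Vx VE sV]] := smallN n x E (open_nbhs_nbhs (conj oE Ex)).
    by exists V => _ _; split => //; exists x.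
  by exists set0 => oE E0; case: nE.
apply: (@choquet_baire _ (fun n E => sigma (n, E))) => [n E oE E0|E oE E0 decE].
  have [? ? clE _] := sigmaP (n, E) oE E0; split => //.
  exact: subset_trans (@subset_closure _ _) clE.
have EP n := sigmaP (n, E n) (oE n) (E0 n).
have decE' n : E n.+1 `<=` E n.
  move=> x /decE sx; have [_ _ + _] := EP n; apply.
  exact: subset_closure.
have [n|n|n|x xP] := smallC (fun n => E n.+1); [exact: E0|exact: decE'| |].
  by apply: smallS (decE n) _; have [] := EP n.
exists x => n _; have [_ _ + _] := EP n; apply => U /xP[m mU].
have [y Ey] := E0 (maxn n m).+1; exists y.
have leE i j : (i <= j)%N -> E j `<=` E i.
  by move=> /subnK <-; elim: (j - i)%N => // k IH z /decE'; exact: IH.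
split; first by apply: decE; apply: leE Ey; rewrite ltnS leq_maxl.
by apply: mU; apply: leE Ey; rewrite ltnS leq_maxr.
Qed.

(** A Souslin scheme on the whole space, along whose branches nonempty sets
    shrink to points: the space is cut into countably many small pieces, each
    of which is cut again, and so on. The pieces need be neither open nor
    disjoint. *)
Definition resolution (T : topologicalType) (B : seq nat -> set T) :=
  [/\ B [::] = setT, forall s, B s = \bigcup_i B (rcons s i)
    & forall a : nat -> nat, (forall n, B (mkseq a n) !=set0) ->
        exists x : T, forall U, nbhs x U -> exists n, B (mkseq a n) `<=` U].

(** The piece of index [s] is the intersection of the sets numbered [s_k] in the
    [k]-th countable cover, for [k] below the length of [s]. *)
Lemma complete_covers_resolution (T : topologicalType)
    (small : nat -> set (set T)) :
  complete_covers small -> exists B : seq nat -> set T, resolution B.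
Proof.
move=> [smallS _ smallC /choice[V VP]].
pose B s := [set x | forall k, (k < size s)%N -> V k (nth 0%N s k) x].
have BE s i : B (rcons s i) = B s `&` V (size s) i.
  apply/seteqP; split=> x.
    move=> Bx; split=> [k ks|].
      by have := Bx k; rewrite size_rcons nth_rcons ks; apply; exact: ltnW.
    by have := Bx (size s); rewrite size_rcons nth_rcons ltnn eqxx; apply.
  move=> [Bx Vx] k; rewrite size_rcons nth_rcons ltnS leq_eqVlt.
  by case: ltngtP => //= [ks _|-> _ //]; exact: Bx.
exists B; split.
- by apply/seteqP; split.
- move=> s; under eq_bigcupr do rewrite BE.
  by rewrite -setI_bigcupr (VP (size s)).2 setIT.
- move=> a B0; have [//|n|n|x xP] := smallC (fun n => B (mkseq a n.+1)).
  + by rewrite [in X in X `<=` _]mkseqS BE; exact: subIsetl.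
  + rewrite mkseqS BE size_mkseq.
    by apply: smallS ((VP n).1 (a n)); exact: subIsetr.
  + by exists x => U /xP[n nU]; exists n.+1.
Qed.

Lemma polish_resolution (R : realType) (T : topologicalType) :
  polish R T -> exists B : seq nat -> set T, resolution B.
Proof.
by move=> /polish_complete_covers[small]; exact: complete_covers_resolution.
Qed.

(** * Analytic sets are comeager where they are heavy *)

(** The form of dependent choice that produces branches of schemes. *)
Lemma branch_exists (I : Type) (P : seq I -> Prop) :
  P [::] -> (forall s, P s -> exists i, P (rcons s i)) ->
  exists a : nat -> I, forall n, P (mkseq a n).
Proof.
move=> P0 PS; have [i0 _] := PS _ P0.
have /choice[g gP] : forall s, exists i, P s -> P (rcons s i).
  move=> s; have [/PS[i Pi]|nPs] := pselect (P s); first by exists i.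
  by exists i0.
pose t := fix t n := if n is m.+1 then rcons (t m) (g (t m)) else [::].
exists (g \o t) => n; suff -> : mkseq (g \o t) n = t n.
  by elim: n => //= n; exact: gP.
by elim: n => // n IH; rewrite mkseqS IH.
Qed.

(** The pieces containing [x] along a branch shrink to a point, which can only
    be [x]. Thus the countably many pieces can replace a countable base. *)
Lemma resolution_network (T : topologicalType) (B : seq nat -> set T) :
  resolution B -> hausdorff_space T ->
  forall x U, nbhs x U -> exists2 s, B s x & B s `<=` U.
Proof.
move=> [B0 BS BC] hT x U Ux.
have [||a Ba] := @branch_exists _ (fun s => B s x); first by rewrite B0.
  by move=> s; rewrite BS => -[i _]; exists i.
have [|y By] := BC a; first by move=> n; exists x.
have xy : x = y.
  apply: hT => V W Vx /By[n BW]; exists x; split; first exact: nbhs_singleton.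
  exact: BW.
by move: Ux; rewrite xy => /By[n nU]; exists (mkseq a n) => //; rewrite -xy.
Qed.

(** The largest open set in which [S] is everywhere nonmeager. *)
Definition heavy_core (T : topologicalType) (S : set T) : set T :=
  [set x : T | forall U, nbhs x U -> ~ meager (S `&` U)]°.

Lemma heavy_core_nonmeager (T : topologicalType) (S U : set T) x :
  heavy_core S x -> nbhs x U -> ~ meager (S `&` U).
Proof. by move/interior_subset; apply. Qed.

Lemma heavy_core_closure (T : topologicalType) (S : set T) :
  heavy_core S `<=` closure S.
Proof.
move=> x Sx U Ux; apply: contrapT => /nonemptyPn SU0.
by apply: (heavy_core_nonmeager Sx Ux); rewrite SU0; exact: meager0.
Qed.

(** A point of [S] that is not heavy either has a neighborhood, hence a piece of
    the countable network, in which [S] is meager, or lies on the boundary of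
    the closed set of points near which [S] is nonmeager. *)
Lemma meager_setD_heavy_core (T : topologicalType) (B : seq nat -> set T)
    (S : set T) :
  resolution B -> hausdorff_space T -> meager (S `\` heavy_core S).
Proof.
move=> rB hT; pose D := [set x : T | forall U, nbhs x U -> ~ meager (S `&` U)].
pose light s := if pselect (meager (S `&` B s)) then S `&` B s else set0.
apply: (@meagerS _ _ ((\bigcup_s light s) `|` (D `\` heavy_core S))).
  move=> x [Sx nhx]; have [Dx|nDx] := pselect (D x); [by right|left].
  have [U nU] := (existsNP _).2 nDx.
  have {nU} [Ux mU] := (not_implyP _ _).1 nU.
  have [s Bx BU] := resolution_network rB hT Ux.
  exists s => //; rewrite /light; case: pselect => // -[].
  by apply: meagerS (contrapT mU); exact: setIS.
apply: meagerU.
  apply: meager_bigcup => s; rewrite /light; case: pselect => [mS|?] /=.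
    exact: mS.
  exact: meager0.
apply/nowhere_dense_meager/nowhere_denseP => U oU [x Ux].
have [UD|nUD] := pselect (U `<=` D).
  exists U; split => //; first by exists x.
  rewrite -subset0 => y [Uy [_]]; apply.
  by apply: (filterS UD); exact: open_nbhs_nbhs.
have [y [Uy nDy]] : exists y, U y /\ ~ D y.
  by have /existsNP[y /not_implyP] := nUD; exists y.
have [V nV] := (existsNP _).2 nDy.
have {nV} [+ /contrapT mV] := (not_implyP _ _).1 nV.
rewrite nbhsE => -[W [oW Wy] WV]; exists (U `&` W); split.
- exact: openI.
- by exists y.
- exact: subIsetl.
- rewrite -subset0 => z [[Uz Wz] [Dz _]].
  apply: (Dz W (open_nbhs_nbhs (conj oW Wz))).
  by apply: meagerS mV; exact: setIS.
Qed.

(** The points of [heavy_core (W s)] that lie in no [heavy_core (W (rcons s i))]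
    are nowhere dense: an open set of such points would meet [W s] in a
    nonmeager set, although it meets each [W (rcons s i)] in a meager set only.
    Away from these countably many exceptional sets every point of
    [heavy_core (W [::])] can be followed along a branch of the scheme. *)
Lemma suslin_scheme_heavy_core (T : topologicalType) (B : seq nat -> set T)
    (I : countType) (W : seq I -> set T) (S : set T) :
  resolution B -> hausdorff_space T ->
  (forall s, W s `<=` \bigcup_i W (rcons s i)) ->
  (forall (a : nat -> I) x, (forall n, closure (W (mkseq a n)) x) -> S x) ->
  meager (heavy_core (W [::]) `\` S).
Proof.
move=> rB hT WS WC.
pose O s := heavy_core (W s); pose bad s := O s `\` \bigcup_i O (rcons s i).
apply: (@meagerS _ _ (\bigcup_s bad s)).
  move=> x [Ox nSx]; apply: contrapT => nbad; apply: nSx.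
  have [||a aP] := @branch_exists _ (fun s => O s x); first by [].
    move=> s Osx; apply: contrapT => nO; apply: nbad.
    by exists s => //; split => // -[i _ Oi]; apply: nO; exists i.
  by apply: (WC a) => n; apply: heavy_core_closure; exact: aP.
apply: meager_bigcup => s; apply/nowhere_dense_meager/nowhere_denseP.
move=> U oU [x Ux]; have [[y [Uy Oy]]|nUO] := pselect (U `&` O s !=set0).
  2:{ exists U; split => //; first by exists x.
      by rewrite -subset0 => y [Uy [Oy _]]; apply: nUO; exists y. }
(* Either [U] meets the heavy core of a subpiece, which is removed from the
   exceptional set, or [W s] is meager in [U], against [y]. *)
have [[i [z [Uz Oz]]]|nUi] := pselect (exists i, U `&` O (rcons s i) !=set0).
  exists (U `&` O (rcons s i)); split.
  - by apply: openI => //; exact: open_interior.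
  - by exists z.
  - exact: subIsetl.
  - by rewrite -subset0 => w [[_ Ow] [_]]; apply; exists i.
exfalso; apply: (heavy_core_nonmeager Oy (open_nbhs_nbhs (conj oU Uy))).
apply: (@meagerS _ _ (\bigcup_i (W (rcons s i) `\` O (rcons s i)))).
  move=> z [/WS[i _ Wi] Uz]; exists i => //; split => // Oi.
  by apply: nUi; exists i, z.
by apply: meager_bigcup => i; exact: meager_setD_heavy_core rB hT.
Qed.

(** * Nonmeager analytic subgroups are open *)

Lemma shift_continuous (X : topologicalZmodType) (a : X) :
  continuous (fun x : X => x + a).
Proof.
move=> x; apply: (@continuous_comp _ _ _ (fun x => (x, a))
  (fun x : X * X => x.1 + x.2)); last exact: add_continuous.
by apply: cvg_pair => /=; [exact: cvg_id|exact: cvg_cst].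
Qed.

Lemma meager_shift (X : topologicalZmodType) (a : X) (S : set X) :
  meager S -> meager [set x | S (x + a)].
Proof.
apply: (@meager_preimage _ _ (fun x : X => x + a) (fun x => x - a)).
- exact: shift_continuous.
- exact: shift_continuous.
- exact: addrK.
- exact: subrK.
Qed.

Lemma subgroupB (X : zmodType) (G : set X) x y :
  subgroup G -> G x -> G y -> G (x - y).
Proof. by move=> [_ GB] Gx Gy; apply/set_mem/GB; apply/mem_set. Qed.

Lemma diffset_subgroup (X : zmodType) (A : set X) :
  A !=set0 -> additive_set A -> subgroup (diffset A).
Proof.
move=> [a0 Aa0] addA; split.
  by apply/mem_set; exists a0 => //; exists a0 => //; exact: subrr.
move=> _ _ /set_mem[a Aa [b Ab <-]] /set_mem[c Ac [d Ad <-]]; apply/mem_set.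
exists (a + d); first by apply: addA; exists a => //; exists d.
exists (b + c); first by apply: addA; exists b => //; exists c.
by rewrite opprB addrACA -opprD.
Qed.

Lemma subgroup_open (X : topologicalZmodType) (G : set X) :
  subgroup G -> nbhs 0 G -> open G.
Proof.
move=> sG G0; rewrite openE => x Gx.
have : nbhs x ((fun y : X => y + (- x)) @^-1` G).
  by apply: (@shift_continuous X (- x) x); rewrite /= subrr.
apply: filterS => y /= Gyx; rewrite -(subrK x y) -[x in _ + x]opprK.
apply: subgroupB => //; rewrite -sub0r; apply: subgroupB => //.
exact: nbhs_singleton.
Qed.

(** If [h] is small, [O] and its translate by [- h] overlap. As [G] is comeager
    in [O], some [x] of the overlap has both [x] and [x + h] in [G]. *)
Lemma pettis_subgroup (X : topologicalZmodType) (G O : set X) :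
  baire X -> subgroup G -> open O -> O !=set0 -> meager (O `\` G) -> open G.
Proof.
move=> bX sG oO [u Ou] mO; apply: subgroup_open => //.
have : nbhs (0 : X) ((fun x : X => x + u) @^-1` O).
  apply: (@shift_continuous X u 0); rewrite /= add0r.
  exact: open_nbhs_nbhs.
apply: filterS => h /= Oh.
have oQ : open (O `&` (fun x : X => x + h) @^-1` O).
  by apply: openI => //; apply: open_comp => // x _; exact: shift_continuous.
have Q0 : O `&` (fun x : X => x + h) @^-1` O !=set0.
  by exists u; split => //; rewrite /preimage/= addrC.
have [x [Ox Oxh] nx] := bX _ _ oQ Q0 (meagerU mO (meager_shift h mO)).
have Gx : G x by apply: contrapT => nG; apply: nx; left.
have Gxh : G (x + h) by apply: contrapT => nG; apply: nx; right.
by rewrite -[h](addKr x) addrC; exact: subgroupB.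
Qed.

Lemma resolution_dec (T : topologicalType) (B : seq nat -> set T) a m n :
  resolution B -> (m <= n)%N -> B (mkseq a n) `<=` B (mkseq a m).
Proof.
move=> [_ BS _] /subnK <-; elim: (n - m)%N => // k IH x Bx; apply: IH.
by rewrite BS; exists (a (k + m)%N) => //; rewrite -mkseqS.
Qed.

(** [diffset A] is the image of the square of the source of [A] under
    [(p, q) |-> f p - f q]. Pairs of pieces of the source, indexed by sequences
    of pairs, form the scheme to which [suslin_scheme_heavy_core] applies. *)
Lemma analytic_diffset_meager (R : realType) (X : topologicalZmodType)
    (A : set X) :
  polish R X -> analytic R A -> subgroup (diffset A) -> ~ open (diffset A) ->
  meager (diffset A).
Proof.
move=> pX [P [pP [f cf fA]]] sG; apply: contra_notP => nmG.
have [BX rBX] := polish_resolution pX; have hX := polish_hausdorff pX.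
have [small /complete_covers_baire bX] := polish_complete_covers pX.
have [B rB] := polish_resolution pP; have [B0 BS BC] := rB.
pose W (s : seq (nat * nat)) := [set z | exists p q,
  [/\ B (map fst s) p, B (map snd s) q & z = f p - f q]].
have W0 : W [::] = diffset A.
  apply/seteqP; split=> [_ [p [q [_ _ ->]]]|_ [a + [b + <-]]].
    by rewrite -fA; exists (f p); [exists p|exists (f q); [exists q|]].
  by rewrite -fA => -[p _ <-] [q _ <-]; exists p, q; rewrite /= B0.
apply: (pettis_subgroup bX sG (O := heavy_core (W [::]))).
- exact: open_interior.
- apply: contrapT => /nonemptyPn E; apply: nmG.
  rewrite -W0 -[W _]setD0 -E; exact: meager_setD_heavy_core rBX hX.
- apply: (suslin_scheme_heavy_core rBX hX) => [s z|a x clx].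
    move=> [p [q [+ + ->]]]; rewrite BS => -[i _ Bp]; rewrite BS => -[j _ Bq].
    by exists (i, j) => //; exists p, q; rewrite !map_rcons.
  have mapE (c : nat * nat -> nat) n : map c (mkseq a n) = mkseq (c \o a) n.
    by rewrite /mkseq -map_comp.
  have WE n : exists p q, B (mkseq (fst \o a) n) p /\ B (mkseq (snd \o a) n) q.
    have [_ [[p [q [Bp Bq _]]] _]] := clx n setT filterT.
    by exists p, q; rewrite -!mapE.
  have [|p Bp] := BC (fst \o a).
    by move=> n; have [p [q []]] := WE n; exists p.
  have [|q Bq] := BC (snd \o a).
    by move=> n; have [p' [q []]] := WE n; exists q.
  suff -> : x = f p - f q.
    by rewrite -fA; exists (f p); [exists p|exists (f q); [exists q|]].
  apply: hX => U V Ux Vpq.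
  have [[U1 U2] /= [U1p U2q] U12] := @sub_continuous X (f p, f q) V Vpq.
  have [m mU] := Bp _ (cf p _ U1p); have [n nU] := Bq _ (cf q _ U2q).
  have [_ [[p' [q' [Bp' Bq' ->]]] Uz]] := clx (maxn m n) U Ux.
  exists (f p' - f q'); split => //; apply: (U12 (f p', f q')); split => /=.
    apply: mU; rewrite mapE in Bp'.
    exact: (resolution_dec rB (leq_maxl _ _) Bp').
  apply: nU; rewrite mapE in Bq'.
  exact: (resolution_dec rB (leq_maxr _ _) Bq').
Qed.

(** * Maps on the Cantor space *)

Lemma nbhs_cylinder (x : cantor_space) k :
  nbhs x [set y : cantor_space | mkseq y k = mkseq x k].
Proof.
elim: k => [|k IH]; first by apply: filterS (@filterT _ _ _).
have : nbhs x ((fun y : cantor_space => y k) @^-1` [set x k]).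
  have := @proj_continuous nat (fun=> bool) k x; apply.
  exact: discrete_set1.
apply: filterS2 IH => y yx /= yk.
by rewrite !mkseqS yx yk.
Qed.

Lemma nbhs_cylinder_sub (x : cantor_space) (U : set cantor_space) :
  nbhs x U -> exists k, [set y : cantor_space | mkseq y k = mkseq x k] `<=` U.
Proof.
pose F := filter_from setT
  (fun k => [set y : cantor_space | mkseq y k = mkseq x k]).
have mkseqW (y : cantor_space) k l : (k <= l)%N -> mkseq y l = mkseq x l ->
    mkseq y k = mkseq x k.
  move=> kl e; apply: (@eq_from_nth _ false); rewrite ?size_mkseq// => i ik.
  have := congr1 (fun s => nth false s i) e.
  by rewrite !nth_mkseq// (leq_trans ik).
have FF : Filter F.
  apply: filter_from_filter; first by exists 0%N.
  move=> i j _ _; exists (maxn i j) => // y /= e.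
  by split; apply: mkseqW e; [exact: leq_maxl|exact: leq_maxr].
suff: F --> x by move=> /[apply] -[k _ kU]; exists k.
apply/cvg_sup => i V [_ [[N oN <-] Nx] NV].
apply: (filterS NV); exists i.+1 => // y /= e.
suff <- : x i = y i by [].
by have := congr1 (fun s => nth false s i) e; rewrite !nth_mkseq.
Qed.

Lemma open_cylinder k (Q : set (seq bool)) :
  open [set x : cantor_space | Q (mkseq x k)].
Proof.
rewrite openE => x Qx; apply: filterS (nbhs_cylinder x k) => y /= yx.
by rewrite yx.
Qed.

Lemma compact_cylinder k (w : seq bool) :
  compact [set x : cantor_space | mkseq x k = w].
Proof.
apply: (subclosed_compact _ cantor_space_compact) => //.
by rewrite -openC; exact: (open_cylinder k (~` [set w])).
Qed.

(** A Lebesgue number for the Cantor space: one length of prefix works for all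
    the points of [K]. *)
Lemma compact_cylinder_sub (K U : set cantor_space) :
  compact K -> open U -> K `<=` U ->
  exists k, forall x y : cantor_space, K x -> mkseq y k = mkseq x k -> U y.
Proof.
move=> cK oU KU.
pose Q k (x : cantor_space) :=
  [set y : cantor_space | mkseq y k = mkseq x k] `<=` U.
have /compact_near_coveringP/(_ _ \oo Q) := cK.
case=> [x Kx|k _ kP]; last first.
  by exists k => x y Kx; exact: (kP k (leqnn k)).
have [k kU] := nbhs_cylinder_sub (open_nbhs_nbhs (conj oU (KU _ Kx))).
exists ([set y : cantor_space | mkseq y k = mkseq x k], [set l | (k <= l)%N]).
  by split; [exact: nbhs_cylinder|exists k].
move=> [y l] /= [yx kl] z /= zy; apply: kU => /=; rewrite -yx.
apply: (@eq_from_nth _ false); rewrite ?size_mkseq// => i ik.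
have := congr1 (fun s => nth false s i) zy.
by rewrite !nth_mkseq// (leq_trans ik).
Qed.

Lemma take_mkseq (T : Type) (x : nat -> T) k l :
  (k <= l)%N -> take k (mkseq x l) = mkseq x k.
Proof.
by move=> /minn_idPl kl; rewrite /mkseq -map_take take_iota kl.
Qed.

Section function_boxes.
Import ArrowAsCompactOpen.
Variable X : topologicalType.
Local Notation C := (continuousType cantor_space X).

(** Maps whose values on each cylinder of depth [k] are confined to an open set
    form a basis of the compact-open topology, by [open_box] and [box_basis].
    Words of any length index [U]; only those of length [k] matter. *)
Definition box k (U : seq bool -> set X) : set C :=
  [set f : C | forall x, U (mkseq x k) (f x)].

Lemma box_take k l (U : seq bool -> set X) : (k <= l)%N ->
  box l (U \o take k) = box k U.
Proof.
move=> kl; apply/seteqP; split=> f fU x; have := fU x;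
by rewrite /= take_mkseq.
Qed.

Lemma step_continuous k (c : seq bool -> X) :
  continuous (fun x : cantor_space => c (mkseq x k)).
Proof.
move=> x U /nbhs_singleton Ux; rewrite nbhs_simpl/=.
by apply: filterS (nbhs_cylinder x k) => y /= ->.
Qed.

Definition step k (c : seq bool -> X) : C := mkcts (@step_continuous k c).

Lemma box_step k (U : seq bool -> set X) c :
  (forall w, U w (c w)) -> box k U (step k c).
Proof. by move=> Uc x; exact: Uc. Qed.

Lemma open_box k (U : seq bool -> set X) :
  (forall w, open (U w)) -> open (box k U).
Proof.
move=> oU; pose K w := [set x : cantor_space | mkseq x k = w].
pose V := \bigcap_(t in [set: k.-tuple bool])
  [set f : cantor_space -> X | f @` K t `<=` U t].
have oV : open V.
  rewrite /V -bigsetI_fset_set; last exact: finite_finset.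
  apply: big_ind => [|? ?|t _]; [exact: openT|exact: openI|].
  apply: compact_open_open => //.
  exact: compact_cylinder.
exists V => //; apply/seteqP; split=> f.
  move=> fV x; have sz : size (mkseq x k) == k by rewrite size_mkseq.
  by apply: (fV (Tuple sz) I); exists x.
by move=> fU t _ _ [x <- <-]; exact: fU.
Qed.

(** The supersets of boxes around [f] form a filter, so only the subbasic
    neighborhoods of [f] have to be treated. For a compact [K] and an open [V],
    take [V] on the cylinders that meet [K] and everything elsewhere, with
    cylinders fine enough to be mapped into [V] as soon as they meet [K]. *)
Lemma box_basis (f : C) (W : set C) : nbhs f W ->
  exists k U, [/\ forall w, open (U w), box k U f & box k U `<=` W].
Proof.
pose F : set_system (cantor_space -> X) := [set V | exists k U,
  [/\ forall w, open (U w), box k U f &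
     forall g : cantor_space -> X, (forall x, U (mkseq x k) (g x)) -> V g]].
have FF : Filter F.
  split.
  - by exists 0%N, (fun=> setT); split => // w; exact: openT.
  - move=> V1 V2 [k1 [U1 [oU1 fU1 UV1]]] [k2 [U2 [oU2 fU2 UV2]]].
    pose k := maxn k1 k2.
    have k1k : (k1 <= k)%N by rewrite leq_maxl.
    have k2k : (k2 <= k)%N by rewrite leq_maxr.
    exists k, (fun w => U1 (take k1 w) `&` U2 (take k2 w)); split.
    + by move=> w; exact: openI.
    + by move=> x; rewrite !take_mkseq.
    + move=> g gU; split; [apply: UV1|apply: UV2] => x;
      by have := gU x; rewrite !take_mkseq// => -[].
  - move=> V1 V2 V12 [k [U [oU fU UV]]]; exists k, U; split => // g /UV.
    exact: V12.
have Ff : F --> (f : cantor_space -> X).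
  apply/compact_open_cvgP => K V cK oV fKV.
  have ofV : open (f @^-1` V) by apply: open_comp => // x _; exact: cts_fun.
  have KfV : K `<=` f @^-1` V by move=> x Kx; apply: fKV; exists x.
  have [k kV] := compact_cylinder_sub cK ofV KfV.
  pose U w := if pselect (exists2 x, K x & mkseq x k = w) then V else setT.
  exists k, U; split.
  - by move=> w; rewrite /U; case: pselect => ? //=; exact: openT.
  - by move=> x; rewrite /U; case: pselect => //= -[y Ky /esym/(kV _ _ Ky)].
  - move=> g gU _ [x Kx <-]; have := gU x; rewrite /U; case: pselect => //= -[].
    by exists x.
move=> [_ [[V oV <-] Vf] VW].
have [k [U [oU fU UV]]] := Ff V (open_nbhs_nbhs (conj oV Vf)).
by exists k, U; split => // g gU; apply: VW; exact: UV.
Qed.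

(** The inclusion no longer mentions a map: any choice of values in the [U w]
    gives a step map in [W]. *)
Lemma open_box_sub (W : set C) m : open W -> W !=set0 ->
  exists k U, [/\ (m <= k)%N, forall w, open (U w), forall w, U w !=set0
    & box k U `<=` W].
Proof.
move=> oW [f Wf].
have [k [U [oU fU UW]]] := box_basis (open_nbhs_nbhs (conj oW Wf)).
(* Words that are not prefixes of length [k] are first normalized, so that the
   values of [f] show every side to be nonempty. *)
pose U' w := U (mkseq (nth false w) k).
exists (maxn m k), (U' \o take k); split.
- exact: leq_maxl.
- by move=> w; exact: oU.
- by move=> w; exists (f (nth false (take k w))); exact: fU.
- rewrite box_take ?leq_maxr// => g gU; apply: UW => x.
  suff -> : mkseq x k = mkseq (nth false (mkseq x k)) k by exact: gU.
  by rewrite -{3}(size_mkseq x k) mkseq_nth.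
Qed.

(** In the Choquet game on the space of maps, answer [E] with a box inside [E]
    whose sides are small and have their closures inside the sides of a bigger
    box contained in [E]. The sides above each point of the Cantor space then
    shrink to one value, and these values form a continuous map. *)
Lemma continuous_map_baire (small : nat -> set (set X)) :
  complete_covers small -> baire C.
Proof.
move=> [smallS smallN smallC _].
have /choice[sigma sigmaP] : forall nE : nat * set C,
    exists kUV : nat * (seq bool -> set X) * (seq bool -> set X),
    let: (k, U, V) := kUV in open nE.2 -> nE.2 !=set0 ->
    [/\ box k U `<=` nE.2, forall w, open (V w), forall w, V w !=set0,
        forall w, closure (V w) `<=` U w & forall w, small nE.1 (V w)].
  move=> [n E]; have [[oE E0]|nE] := pselect (open E /\ E !=set0); last first.
    by exists (0%N, fun=> set0, fun=> set0) => oE E0; case: nE.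
  have [k [U [_ oU U0 UE]]] := open_box_sub 0 oE E0.
  have /choice[V VP] : forall w, exists V, [/\ open V, V !=set0,
      closure V `<=` U w & small n V].
    move=> w; have [x Ux] := U0 w.
    have [V [oV Vx VU sV]] := smallN n x _ (open_nbhs_nbhs (conj (oU w) Ux)).
    by exists V; split => //; exists x.
  exists (k, U, V) => _ _; split => // w; by have [] := VP w.
pose K nE := (sigma nE).1.1; pose U nE := (sigma nE).1.2.
pose V nE := (sigma nE).2.
have sP nE : open nE.2 -> nE.2 !=set0 ->
    [/\ box (K nE) (U nE) `<=` nE.2, forall w, open (V nE w),
        forall w, V nE w !=set0, forall w, closure (V nE w) `<=` U nE w
      & forall w, small nE.1 (V nE w)].
  by have := sigmaP nE; rewrite /K /U /V; case: (sigma nE) => [[]].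
have VU nE : open nE.2 -> nE.2 !=set0 -> box (K nE) (V nE) `<=` nE.2.
  move=> oE E0; have [UE _ _ clU _] := sP _ oE E0.
  by move=> f fV; apply: UE => x; apply: clU; exact: subset_closure.
apply: (@choquet_baire _ (fun n E => box (K (n, E)) (V (n, E)))).
  move=> n E oE E0; have [UE oV V0 _ _] := sP (n, E) oE E0; split.
  - exact: open_box.
  - have /choice[c cP] : forall w, exists x, V (n, E) w x := V0.
    exists (step (K (n, E)) c); exact: box_step.
  - exact: VU.
move=> E oE E0 decE.
have EP n := sP (n, E n) (oE n) (E0 n).
have decE' n : E n.+1 `<=` E n.
  by move=> f /decE; exact: (VU (n, E n) (oE n) (E0 n)).
pose k n := K (n, E n).
(* The intersection of the sides above [x] depends only on a finite prefix of
   [x], which makes the limit map continuous. *)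
pose D (x : cantor_space) n :=
  \bigcap_(j < n.+1) V (j, E j) (mkseq x (k j)).
have leE i j : (i <= j)%N -> E j `<=` E i.
  by move=> /subnK <-; elim: (j - i)%N => // l IH z /decE'; exact: IH.
have ED f x n : E n.+1 f -> D x n (f x).
  by move=> Ef j /= jn; apply: (decE j); exact: leE Ef.
have DV x n : D x n `<=` V (n, E n) (mkseq x (k n)).
  by move=> y /(_ n); apply => /=.
have decD x m n : (m <= n)%N -> D x n `<=` D x m.
  by move=> mn y Dy j /= jm; apply: Dy => /=; exact: leq_trans jm _.
have D0 x n : D x n !=set0 by have [f Ef] := E0 n.+1; exists (f x); exact: ED.
have /choice[f fP] : forall x, exists y : X, forall W, nbhs y W ->
    exists n, D x n `<=` W.
  move=> x; apply: smallC => [n|n|n]; [exact: D0|exact: decD|].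
  by apply: smallS (DV x n) _; have [] := EP n.
have fD x n : closure (D x n) (f x).
  move=> W /fP[m mW]; have [y Dy] := D0 x (maxn n m); exists y; split.
    by apply: decD Dy; exact: leq_maxl.
  by apply: mW; apply: decD Dy; exact: leq_maxr.
have cf : continuous f.
  move=> x W fW; have [W' [oW' W'x W'W _]] := smallN 0 _ _ fW.
  have [n nW'] := fP x W' (open_nbhs_nbhs (conj oW' W'x)).
  suff near_x : nbhs x [set y | D y n = D x n].
    apply: filterS near_x => y /= Dyx; apply: W'W.
    by apply: closureS (fD y n); rewrite Dyx.
  elim: n {nW'} => [|n IH].
    apply: filterS (nbhs_cylinder x (k 0%N)) => y /= yx.
    by rewrite /D !bigcap_mkord !big_ord1 yx.
  apply: filterS2 IH (nbhs_cylinder x (k n.+1)) => y /=.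
  by rewrite /D !bigcap_mkord => eD yx; rewrite !(big_ord_recr n.+1)/= eD yx.
exists (mkcts cf : C) => n _; have [UE _ _ clU _] := EP n.
by apply: UE => x; apply: clU; apply: closureS (DV x n) _ (fD x n).
Qed.
End function_boxes.

(** * Generic maps separate the cosets of a meager subgroup *)

Lemma card_le_I1 (T : Type) (S : set T) :
  (S #<= `I_1) <-> (forall x y, S x -> S y -> x = y).
Proof.
split=> [/pcard_leP[f] x y Sx Sy|sub].
  have f0 z : S z -> f z = 0%N.
    by move=> /(@funS _ _ _ _ f)/=; case: (f z).
  apply: (@inj _ _ _ f); rewrite ?inE//.
  exact: etrans (f0 _ Sx) (esym (f0 _ Sy)).
have [[x Sx]|/nonemptyPn ->] := pselect (S !=set0); last exact: card_ge0.
apply: (@card_le_trans _ _ _ [set x]); last by rewrite (card_le_eql card_set1).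
by apply: subset_card_le => y Sy; exact: sub.
Qed.

(** Fix [y] in [V]: since [M] is nowhere dense, some [x] in [U] has [x - y] in
    an open set disjoint from [M], and continuity of the difference does the
    rest. *)
Lemma nowhere_dense_separate (X : topologicalZmodType) (M U V : set X) :
  nowhere_dense M -> open U -> U !=set0 -> open V -> V !=set0 ->
  exists U' V', [/\ open U' /\ U' !=set0, open V' /\ V' !=set0,
    U' `<=` U, V' `<=` V & forall x y, U' x -> V' y -> ~ M (x - y)].
Proof.
move=> ndM oU [u Uu] oV [y Vy].
have oUy : open ((fun x : X => x + y) @^-1` U).
  by apply: open_comp => // x _; exact: shift_continuous.
have Uy0 : (fun x : X => x + y) @^-1` U !=set0.
  by exists (u - y); rewrite /preimage/= subrK.
have [Z [oZ [z Zz] ZU ZM]] := (nowhere_denseP M).1 ndM _ oUy Uy0.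
have Zzy : nbhs (z + y - y) Z by rewrite addrK; exact: open_nbhs_nbhs.
have [[P Q] /= [Pz Qy] PQ] := @sub_continuous X (z + y, y) Z Zzy.
move: Pz Qy; rewrite !nbhsE => -[P' [oP' P'z] P'P] [Q' [oQ' Q'y] Q'Q].
exists (U `&` P'), (V `&` Q'); split.
- by split; [exact: openI|exists (z + y); split => //; exact: ZU].
- by split; [exact: openI|exists y].
- exact: subIsetl.
- exact: subIsetl.
- move=> a b [_ /P'P Pa] [_ /Q'Q Qb] Mab.
  have Zab : Z (a - b) by apply: (PQ (a, b)).
  by have : set0 (a - b) by rewrite -ZM.
Qed.

(** Shrinking the family preserves what was achieved for the pairs already
    treated, so the pairs can be treated one after the other. *)
Lemma nowhere_dense_separate_family (X : topologicalZmodType) (I : eqType)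
    (M : set X) (l : seq (I * I)) (U : I -> set X) :
  nowhere_dense M -> (forall i, open (U i)) -> (forall i, U i !=set0) ->
  exists V : I -> set X, [/\ forall i, open (V i), forall i, V i !=set0,
    forall i, V i `<=` U i
  & forall i j, (i, j) \in l -> i != j ->
      forall x y, V i x -> V j y -> ~ M (x - y)].
Proof.
move=> ndM oU U0; elim: l => [|[i j] l [V [oV V0 VU VM]]].
  by exists U; split=> // i; exact: subset_refl.
have [P [Q [[oP P0] [oQ Q0] PV QV PQM]]] :=
  nowhere_dense_separate ndM (oV i) (V0 i) (oV j) (V0 j).
have [<-|ij] := eqVneq i j.
  exists V; split=> [//|//|//|a b]; rewrite in_cons => /orP[/eqP[-> ->]|].
    by rewrite eqxx.
  exact: VM.
pose V' a := if a == i then P else if a == j then Q else V a.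
have V'V a : V' a `<=` V a.
  rewrite /V'; case: eqVneq => [->//|_]; case: eqVneq => [->//|_].
  exact: subset_refl.
exists V'; split.
- by move=> a; rewrite /V'; do 2 case: ifP => // _.
- by move=> a; rewrite /V'; do 2 case: ifP => // _.
- by move=> a; exact: subset_trans (V'V a) (VU a).
- move=> a b; rewrite in_cons.
  move=> /orP[/eqP[-> ->] _ x y|abl ab x y /V'V ax /V'V].
    by rewrite /V' eqxx eq_sym (negPf ij) eqxx; exact: PQM.
  exact: (VM _ _ abl ab _ _ ax).
Qed.

Section generic_maps.
Import ArrowAsCompactOpen.
Variable X : topologicalZmodType.
Local Notation C := (continuousType cantor_space X).

(** The depth [k] of the box is taken at least [m], so that prefixes differing
    at depth [m] lie in different cylinders, the values on which have been
    separated. *)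
Lemma nowhere_dense_collision (M : set X) m : nowhere_dense M ->
  nowhere_dense [set f : C | exists s t : cantor_space,
    mkseq s m <> mkseq t m /\ M (f s - f t)].
Proof.
move=> ndM; apply/nowhere_denseP => W oW W0.
have [k [U [mk oU U0 UW]]] := open_box_sub m oW W0.
pose l := [seq (val p.1, val p.2)
  | p <- enum {: k.-tuple bool * k.-tuple bool}].
have [V [oV V0 VU VM]] := nowhere_dense_separate_family l ndM oU U0.
have /choice[c cP] : forall w, exists x, V w x := V0.
exists (box k V); split.
- exact: open_box.
- by exists (step k c); exact: box_step.
- by move=> f fV; apply: UW => x; apply: VU; exact: fV.
- rewrite -subset0 => f [fV [s [t [st]]]].
  apply: (VM (mkseq s k) (mkseq t k)); [| |exact: fV|exact: fV].
    have ss : size (mkseq s k) == k by rewrite size_mkseq.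
    have tt' : size (mkseq t k) == k by rewrite size_mkseq.
    by apply/mapP; exists (Tuple ss, Tuple tt'); rewrite ?mem_enum.
  by apply/eqP => e; apply: st; rewrite -(take_mkseq s mk) e take_mkseq.
Qed.

Lemma generically_haar_diffset (A : set X) :
  meager (diffset A) -> generically_haar 1 A.
Proof.
move=> [F ndF AF]; rewrite /generically_haar /comeager.
pose N (nm : nat * nat) := [set f : C | exists s t : cantor_space,
    mkseq s nm.2 <> mkseq t nm.2 /\ F nm.1 (f s - f t)].
apply: (@meagerS _ _ (\bigcup_nm N nm)); last first.
  apply: meager_bigcup => nm; apply: nowhere_dense_meager.
  exact: nowhere_dense_collision.
move=> f /existsNP[x /card_le_I1 nf]; apply: contrapT => nN; apply: nf => s t.
move=> [a Aa fs] [b Ab ft]; apply: contrapT => st; apply: nN.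
have [m stm] : exists m, s m <> t m.
  by apply/existsNP => e; apply: st; apply/funext.
have : diffset A (f s - f t).
  by exists a => //; exists b => //; rewrite -fs -ft opprD addrACA subrr add0r.
rewrite AF => -[n _ Fn]; exists (n, m.+1) => //; exists s, t; split => // e.
by apply: stm; have := congr1 (fun s => nth false s m) e; rewrite !nth_mkseq.
Qed.

Lemma generically_haar_ex n (A : set X) : baire C -> generically_haar n A ->
  exists f : C, forall x, f @^-1` translate x A #<= `I_n.
Proof.
have C0 : [set: C] !=set0 by exists (step 0 (fun=> 0)).
move=> bC gA; have [f _ /contrapT fA] := bC setT _ openT C0 gA.
by exists f.
Qed.
End generic_maps.

(** * Null sequences and finite thickness *)

(** The embedding of the convergent sequence sends [n] to the indicator of [n],
    and the limit to the zero sequence. *)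
Definition omega_cantor (z : order_topology omega_plus1) : cantor_space :=
  fun i => z == Some i.

Lemma omega_cantor_inj : injective omega_cantor.
Proof.
move=> [m|] [n|] // e; first 1 last.
- by have := congr1 (@^~ m) e; rewrite /omega_cantor eqxx.
- by have := congr1 (@^~ n) e; rewrite /omega_cantor eqxx.
by have := congr1 (@^~ m) e; rewrite /omega_cantor eqxx => /esym/eqP.
Qed.

(** Each coordinate is the indicator of some [Some i], a point that is open,
    being isolated by its neighbors in the order, and also closed. *)
Lemma omega_cantor_continuous : continuous omega_cantor.
Proof.
move=> z; have FF : Filter (omega_cantor x @[x --> z]).
  exact/fmap_filter/nbhs_filter.
apply/cvg_sup => i V [_ [[N oN <-] Nz] NV].
apply: (filterS NV); rewrite nbhs_simpl/=.
suff : nbhs z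
    [set y : order_topology omega_plus1 | (y == Some i) = (z == Some i)].
  by apply: filterS => y /= yz; move: Nz; rewrite /preimage/= /omega_cantor yz.
pose som n : order_topology omega_plus1 := Some n.
have leE (x y : order_topology omega_plus1) : (x <= y)%O = omega_le x y by [].
(* At [Some i] the neighborhood is the point itself, cut out by [Some i.+1] and,
   unless [i = 0], by the predecessor of [Some i]. *)
have [->|zi] := eqVneq z (Some i).
  have ub : nbhs (som i) `]-oo, som i.+1[%classic.
    apply: open_nbhs_nbhs; split; first exact: lray_open.
    by rewrite /= in_itv/= ltNge leE/= ltnn.
  case: i {V N oN Nz NV} ub => [|i] ub.
    apply: filterS ub => -[[|n]|] //=.
    by rewrite in_itv/= ltNge leE/=.
  have : nbhs (som i.+1) `]som i, +oo[%classic.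
    apply: open_nbhs_nbhs; split; first exact: rray_open.
    by rewrite /= in_itv/= andbT ltNge leE/= ltnn.
  apply: filterS2 ub => -[n|] /=; rewrite !in_itv/= ?andbT !ltNge !leE//=.
  rewrite -!ltnNge !ltnS => ni im; apply/eqP; congr Some.
  by apply/eqP; rewrite eqn_leq ni.
have [lt|lt] : (z < som i)%O \/ (som i < z)%O by apply/orP; rewrite -neq_lt.
  have : nbhs z `]-oo, som i[%classic.
    apply: open_nbhs_nbhs; split; first exact: lray_open.
    by rewrite /= in_itv.
  apply: filterS => y /=; rewrite in_itv/= => yi.
  by apply/eqP => e; rewrite e ltxx in yi.
have : nbhs z `]som i, +oo[%classic.
  apply: open_nbhs_nbhs; split; first exact: rray_open.
  by rewrite /= in_itv/= andbT.
apply: filterS => y /=; rewrite in_itv/= andbT => yi.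
by apply/eqP => e; rewrite e ltxx in yi.
Qed.

Lemma nbhs_omega_tail (S : set (order_topology omega_plus1)) :
  nbhs (None : order_topology omega_plus1) S ->
  exists m, forall k, (m <= k)%N -> S (Some k).
Proof.
have leE (x y : order_topology omega_plus1) : (x <= y)%O = omega_le x y by [].
rewrite itv_nbhsE => -[[a b] [oab Nab] sub].
exists (if a is BSide _ (Some p) then p.+1 else 0%N) => k mk; apply: sub => /=.
move: oab Nab mk; rewrite !in_itv.
case: a b => [[] [p|]|[]] [[] [q|]|[]] //=; rewrite !ltNge !leE //= ?andbT.
by rewrite -ltnNge.
Qed.

(** The first [n + 1] terms of a tail of the sequence within [H] of its limit
    are counted with their indices: they may coincide as points, but the
    preimage under the sequence still has [n + 1] elements. *)
Lemma null_n_not_finitely_thick (X : topologicalZmodType) (A H : set X) n :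
  null_n n A -> open H -> subgroup H -> ~ finitely_thick H A.
Proof.
move=> [f cf fA] oH sH thick.
have H0 : H 0 by have [/set_mem] := sH.
have fH : nbhs (None : order_topology omega_plus1)
    [set z : order_topology omega_plus1 | H (f z - f None)].
  apply: (cf None [set y | H (y - f None)]).
  apply: (@shift_continuous X (- f None)); rewrite subrr.
  exact: open_nbhs_nbhs.
have [m mH] : exists m, forall k, (m <= k)%N -> H (f (Some k) - f None).
  exact: nbhs_omega_tail fH.
pose F := [set f (Some (m + i)%N) - f None | i in `I_n.+1].
have finF : finite_set F by exact/finite_image/finite_II.
have FH : F `<=` H by move=> _ [i _ <-]; apply: mH; exact: leq_addr.
have [x Hx Fx] := thick F finF FH.
have le_n : [set (Some (m + i)%N : order_topology omega_plus1)
             | i in `I_n.+1] #<= `I_n.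
  apply: card_le_trans (fA (f None + x)); apply: subset_card_le => _ [i Ii <-].
  have [a Aa xa] : translate x A (f (Some (m + i)%N) - f None).
    by apply: Fx; exists i.
  by exists a => //; rewrite -addrA xa addrC subrK.
move: le_n; rewrite (card_le_eql (inj_card_eq _)); last first.
  by move=> i j _ _ [/addnI].
by rewrite card_le_II ltnn.
Qed.

(** Given finitely many differences [a - b], a sum [x] of all the elements [b]
    satisfies [x + (a - b)] in [A] for each of them. The induction starts from
    an arbitrary element of [A], which keeps [x] itself in [A]. *)
Lemma finitely_thick_diffset (X : zmodType) (A : set X) :
  A !=set0 -> additive_set A -> finitely_thick (diffset A) A.
Proof.
move=> [a0 Aa0] addA F /finite_seqP[s ->] sA.
have {sA}[x Ax xs] : exists2 x, A x & forall y, y \in s -> A (x + y).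
  elim: s sA => [|y s IH] sA; first by exists a0.
  have [z zs|x Ax xs] := IH; first by apply: sA; rewrite /= inE zs orbT.
  have [a Aa [b Ab ab]] : diffset A y by apply: sA; rewrite /= inE eqxx.
  exists (x + b); first by apply: addA; exists x => //; exists b.
  move=> z; rewrite inE => /orP[/eqP ->|/xs Axz]; apply: addA.
    by exists x => //; exists a => //; rewrite -ab addrACA subrr addr0.
  by exists (x + z) => //; exists b => //; rewrite addrAC.
exists (- x).
  exists x => //; exists (x + x).
    by apply: addA; exists x => //; exists x.
  by rewrite opprD addNKr.
by move=> y /= /xs Axy; exists (x + y) => //; rewrite addKr.
Qed.

Lemma sub_diffset (X : zmodType) (A : set X) :
  additive_set A -> A `<=` diffset A.
Proof.
move=> addA a Aa; exists (a + a).
  by apply: addA; exists a => //; exists a.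
by exists a => //; rewrite addrK.
Qed.

Theorem theorem18p1 (R : realType) (X : topologicalZmodType) (A : set X) :
  polish R X -> A !=set0 -> additive_set A -> analytic R A ->
  [<-> ~ open (diffset A);
       meager (diffset A);
       generically_haar 1 A;
       exists2 n : nat, (0 < n)%N & null_n n A;
       forall H : set X, open H -> subgroup H -> A `<=` H ->
         ~ finitely_thick H A].
Proof.
move=> pX A0 addA anA; have sG := diffset_subgroup A0 addA; tfae.
- exact: analytic_diffset_meager pX anA sG.
- exact: generically_haar_diffset.
- have [small /continuous_map_baire bC] := polish_complete_covers pX.
  move=> /(generically_haar_ex bC)[f fA].
  exists 1%N => //; exists (f \o omega_cantor).
    move=> z; apply: continuous_comp; last exact: cts_fun.
    exact: omega_cantor_continuous.
  move=> x; apply/card_le_I1 => y z fy fz; apply: omega_cantor_inj.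
  by have /card_le_I1 := fA x; apply.
- by move=> [n _ nA] H oH sH _; exact: null_n_not_finitely_thick nA oH sH.
- move=> nthick oG; apply: (nthick _ oG sG (sub_diffset addA)).
  exact: finitely_thick_diffset.
Qed.
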